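(* There exist universal constants $c_0 \in (0,1)$ and $C > 0$ such that the following holds. Let $t \ge 0$, let $n, k, p$ be positive integers with $k \le c_0 p$, let $\beta^\natural \in \mathbb{R}^p$ be a $k$-sparse vector (at most $k$ non-zero coordinates), and let $K := \|\beta^\natural\|_1 B_1^p$, where $B_1^p$ is the $\ell^1$-unit ball in $\mathbb{R}^p$ (so $\beta^\natural$ lies on the boundary of $K$). Then: (i) $q_{t,n}^{(2,0)}(K - \beta^\natural) \le C \, m_t^{(2,0)}(K - \beta^\natural)$ and $m_t^{(2,0)}(K - \beta^\natural) \le C \sqrt{k \log(p/k)}$. (ii) $q_{t,n}^{(2,\infty)}(K - \beta^\natural) \le C \, m_t^{(2,\infty)}(K - \beta^\natural)$ and $m_t^{(2,\infty)}(K - \beta^\natural) \le C \sqrt{k \log(p/k) \log(p)}$. (iii) $q_{t,n}^{(0,2)}(K - \beta^\natural) \le C \, m_t^{(0,2)}(K - \beta^\natural)$ and $m_t^{(0,2)}(K - \beta^\natural) \le C \sqrt{k} \cdot \log(2p)$.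
   Context: $\mathbb{S}^{p-1}$ is the Euclidean unit sphere in $\mathbb{R}^p$; $\operatorname{cone}$ and $\operatorname{conv}$ denote conic and convex hull. A constant is universal if it does not depend on any other parameter. $\gamma$-functional: for a set $L$ with pseudo-metric $d$ and $\alpha \in \{1,2\}$, $\gamma_\alpha(L,d) := \inf \sup_{v \in L} \sum_{s=0}^\infty 2^{s/\alpha} \Delta(A_s(v))$, where the infimum is over all increasing sequences $(\mathcal{A}_s)_{s \ge 0}$ of partitions of $L$ (every $A \in \mathcal{A}_{s+1}$ is contained in some $B \in \mathcal{A}_s$) with $|\mathcal{A}_0| = 1$ and $|\mathcal{A}_s| \le 2^{2^s}$ for $s \ge 1$, $A_s(v)$ is the element of $\mathcal{A}_s$ containing $v$, and $\Delta$ is the diameter with respect to $d$. For a semi-norm $\|\cdot\|$, $\gamma_\alpha(L, \|\cdot\|)$ uses the induced pseudo-metric. For $L \subset \mathbb{R}^p$, set $L_t := \tfrac{1}{t} L \cap \mathbb{S}^{p-1}$ for $t > 0$ and $L_0 := \operatorname{cone}(L) \cap \mathbb{S}^{p-1}$. The local ($t > 0$) and conic ($t = 0$) q- and m-complexities are, with all infima over $S \subset \mathbb{R}^p$: $q_{t,n}^{(2,0)}(L) := \inf\{\gamma_2(S, \|\cdot\|_2) : \operatorname{conv}(S) \supset L_t\}$, $m_t^{(2,0)}(L) := \inf\{\gamma_2(S, \|\cdot\|_2) : \operatorname{conv}(S) \supset L_t \cup \{0\}\}$; $q_{t,n}^{(2,\infty)}(L) := \inf\{\tfrac{1}{\sqrt{n}}\gamma_1(S,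 \|\cdot\|_\infty) + \gamma_2(S, \|\cdot\|_2) : \operatorname{conv}(S) \supset L_t\}$, $m_t^{(2,\infty)}(L) := \inf\{\gamma_1(S, \|\cdot\|_\infty) + \gamma_2(S, \|\cdot\|_2) : \operatorname{conv}(S) \supset L_t \cup \{0\}\}$; $q_{t,n}^{(0,2)}(L) := \inf\{\tfrac{1}{\sqrt{n}}\gamma_1(S, \|\cdot\|_2) + \gamma_2(S, \|\cdot\|_2) : \operatorname{conv}(S) \supset L_t\}$, $m_t^{(0,2)}(L) := \inf\{\gamma_1(S, \|\cdot\|_2) : \operatorname{conv}(S) \supset L_t \cup \{0\}\}$. *)

(* Defs.v *)
From mathcomp Require Import all_boot all_order all_algebra.
From mathcomp Require Import all_classical all_reals all_analysis.

Set Implicit Arguments.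
Unset Strict Implicit.
Unset Printing Implicit Defensive.

Import Order.TTheory GRing.Theory Num.Theory.
Import numFieldNormedType.Exports.

Local Open Scope classical_set_scope.
Local Open Scope ring_scope.

Section GammaFunctional.
Context {R : realType} {T : Type}.
Implicit Types (d : T -> T -> R) (L : set T) (A : nat -> set (set T)).

Definition diameter d (B : set T) : \bar R :=
  ereal_sup [set (d x y)%:E | x in B & y in B].

(* The library's [partition] requires nonempty blocks, so the empty set has no
   admissible sequence and its gamma-functional is [+oo]. *)
Definition admissible L A : Prop :=
  [/\ forall s, partition (A s) id L,
      forall s B, A s.+1 B -> exists2 B', A s B' & B `<=` B',
      (A 0%N #= `I_1)%card
    & forall s, (1 <= s)%N -> (A s #<= `I_(2 ^ (2 ^ s)))%card].

(* [pblock (A s) id v] is the block of the partition [A s] containing [v]. *)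
Definition gamma_functional (alpha : nat) d L : \bar R :=
  ereal_inf
    [set ereal_sup
       [set (\sum_(0 <= s <oo)
          (2 `^ (s%:R / alpha%:R))%:E * diameter d (pblock (A s) id v))%E
       | v in L]
    | A in admissible L].

End GammaFunctional.

Section Vectors.
Context {R : realType} {p : nat}.
Implicit Types (v beta : 'rV[R]_p) (L S : set 'rV[R]_p) (t : R) (n k : nat).

Definition norm1 v : R := \sum_j `|v 0 j|.
Definition norm2 v : R := Num.sqrt (\sum_j v 0 j ^+ 2).
(* The norm with which the library equips matrices is the sup norm. *)
Definition norm_infty v : R := `|v|.

Definition gamma (alpha : nat) (N : 'rV[R]_p -> R) S : \bar R :=
  gamma_functional alpha (fun x y => N (x - y)) S.

Definition sphere : set 'rV[R]_p := [set v | norm2 v = 1].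

Definition l1_ball : set 'rV[R]_p := [set v | norm1 v <= 1].

Definition sparse k beta : Prop := (#|[pred j | beta ord0 j != 0%R]| <= k)%N.

Definition conv_hull L : set 'rV[R]_p :=
  [set v | exists m (a : 'I_m -> R) (x : 'I_m -> 'rV[R]_p),
    [/\ forall i, 0 <= a i, \sum_i a i = 1, forall i, L (x i)
      & v = \sum_i a i *: x i]].

Definition conic_hull L : set 'rV[R]_p :=
  [set v | exists m (a : 'I_m -> R) (x : 'I_m -> 'rV[R]_p),
    [/\ forall i, 0 <= a i, forall i, L (x i) & v = \sum_i a i *: x i]].

Definition localized t L : set 'rV[R]_p :=
  (if t == 0 then conic_hull L else [set t^-1 *: x | x in L]) `&` sphere.

Definition q_complexity (F : set 'rV[R]_p -> \bar R) t L : \bar R :=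
  ereal_inf [set F S | S in [set S | localized t L `<=` conv_hull S]].

Definition m_complexity (F : set 'rV[R]_p -> \bar R) t L : \bar R :=
  ereal_inf
    [set F S | S in [set S | localized t L `|` [set 0] `<=` conv_hull S]].

(* [n] is a dummy parameter here, kept for uniformity with [q_2_infty] and
   [q_0_2]. *)
Definition q_2_0 t n L : \bar R := q_complexity (gamma 2 norm2) t L.

Definition m_2_0 t L : \bar R := m_complexity (gamma 2 norm2) t L.

Definition q_2_infty t n L : \bar R :=
  q_complexity (fun S => ((Num.sqrt n%:R)^-1)%:E * gamma 1 norm_infty S
                         + gamma 2 norm2 S)%E t L.

Definition m_2_infty t L : \bar R :=
  m_complexity (fun S => gamma 1 norm_infty S + gamma 2 norm2 S)%E t L.

Definition q_0_2 t n L : \bar R :=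
  q_complexity (fun S => ((Num.sqrt n%:R)^-1)%:E * gamma 1 norm2 S
                         + gamma 2 norm2 S)%E t L.

Definition m_0_2 t L : \bar R := m_complexity (gamma 1 norm2) t L.

End Vectors.

(* Main.v *)
(** With L = ln (p / k), every localization of K - beta consists of unit vectors
    of the descent cone of the l1-norm at beta, hence of l1-norm at most
    2 sqrt k.  Such a vector, scaled by sqrt k, can be rounded to integer vectors
    z with sum z_j^2 <= 6k without leaving the convex hull, and this net has
    exp(O(kL)) points of bounded l2-norm, whence gamma_2 = O(sqrt (kL)).
    Truncating z to the coordinates with |z_j|^3 >= 4^u leaves only
    exp(10 kL / 2^u) vectors while moving z by at most (8/5)^u in sup norm;
    since 8/5 < 2, chaining along these truncations gives
    gamma_1 = O(sqrt k L) for the sup norm.  For (iii) the vertices of a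
    cross-polytope of radius 2 sqrt k suffice.  The bounds of q by m hold set by
    set, using gamma_2 <= gamma_1. *)
Require Import Defs.
From mathcomp Require Import all_boot all_order all_algebra.
From mathcomp Require Import all_classical all_reals all_analysis.
From mathcomp Require Import ring lra zify.

Set Implicit Arguments.
Unset Strict Implicit.
Unset Printing Implicit Defensive.

Import Order.TTheory GRing.Theory Num.Theory.
Import numFieldNormedType.Exports.

Local Open Scope classical_set_scope.
Local Open Scope ring_scope.

(** * Upper bounds on the gamma-functional *)

Section GammaFunctional.
Context {R : realType} {T : Type}.
Implicit Types (d : T -> T -> R) (L : set T) (A : nat -> set (set T)).

Lemma pblock_eq (P : set (set T)) L B v :
  partition P id L -> P B -> B v -> pblock P id v = B.
Proof.
move=> [_ triv _] PB Bv; apply: triv => //.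
  by case: (@xgetPex _ point [set i | P i /\ i v]); [exists B|].
exists v; split=> //.
by case: (@xgetPex _ point [set i | P i /\ i v]); [exists B|].
Qed.

Lemma pblock_mem (P : set (set T)) L v :
  partition P id L -> L v -> P (pblock P id v) /\ pblock P id v v.
Proof.
move=> PL; have [cov _ _] := PL; rewrite -cov => -[B PB Bv].
by rewrite (pblock_eq PL PB Bv).
Qed.

Lemma diameter_ge0 d (B : set T) v : 0 <= d v v -> B v -> (0 <= diameter d B)%E.
Proof.
by move=> d0 Bv; apply: (@le_trans _ _ (d v v)%:E);
  [rewrite lee_fin|apply: ereal_sup_ubound; exists v => //; exists v].
Qed.

(** A family of cardinality one has a block, and blocks of a [partition] are nonempty. The point
    found serves to bound the inner supremum from below. *)
Lemma admissible_nonempty L A : admissible L A -> L !=set0.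
Proof.
move=> [PL _ A0 _]; have [cov _ ne] := PL 0%N.
have [B AB] : A 0%N !=set0.
  apply/set0P/eqP => A00; move: A0; rewrite A00 => /card_esym.
  by rewrite card_eq0 => /eqP/seteqP[+ _] => /(_ 0%N)/= /(_ isT).
by have [v Bv] := ne _ AB; exists v; rewrite -cov; exists B.
Qed.

Definition chain_sum (alpha : nat) d A v : \bar R :=
  (\sum_(0 <= s <oo)
     (2 `^ (s%:R / alpha%:R))%:E * diameter d (pblock (A s) id v))%E.

Lemma chain_term_ge0 alpha d L A v s : (forall x, 0 <= d x x) ->
  admissible L A -> L v ->
  (0 <= (2 `^ (s%:R / alpha%:R))%:E * diameter d (pblock (A s) id v))%E.
Proof.
move=> d0 [PL _ _ _] Lv; rewrite mule_ge0 ?lee_fin ?powR_ge0//.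
by apply: diameter_ge0 (d0 v) _; have [] := pblock_mem (PL s) Lv.
Qed.

Lemma gamma_functional_ge0 alpha d L : (forall x, 0 <= d x x) ->
  (0 <= gamma_functional alpha d L)%E.
Proof.
move=> d0; apply: le_ereal_inf_tmp => _ [A adA <-].
have [v Lv] := admissible_nonempty adA.
apply: (@le_trans _ _ (chain_sum alpha d A v)).
  by apply: nneseries_ge0 => s _ _; exact: chain_term_ge0 adA Lv.
by apply: ereal_sup_ubound; exists v.
Qed.

(** Admissibility does not involve [alpha], so the same partitions serve both sides; the weights
    compare since s/2 <= s. *)
Lemma gamma_functional2_le1 d L : (forall x, 0 <= d x x) ->
  (gamma_functional 2 d L <= gamma_functional 1 d L)%E.
Proof.
move=> d0; apply: le_ereal_inf_tmp => _ [A adA <-].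
apply: (@le_trans _ _ (ereal_sup [set chain_sum 2 d A v | v in L])).
  by apply: ereal_inf_lbound; exists A.
apply: ge_ereal_sup => _ [v Lv <-].
apply: (@le_trans _ _ (chain_sum 1 d A v)); last first.
  by apply: ereal_sup_ubound; exists v.
apply: lee_nneseries => s _; first by move=> _; exact: chain_term_ge0 adA Lv.
apply: lee_wpmul2r.
  have [PL _ _ _] := adA.
  by apply: diameter_ge0 (d0 v) _; have [] := pblock_mem (PL s) Lv.
rewrite lee_fin ler_powR ?ler1n// ler_wpM2l// invr1.
by rewrite invf_le1// ler1n.
Qed.

(* The fibres of the labellings [f s] on [L] form the partitions. *)
Lemma gamma_functional_le_chain (U : Type) (f : nat -> T -> U)
    (alpha : nat) d L (delta : nat -> R) (N : nat) (M : R) :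
  L !=set0 ->
  (forall x y, L x -> L y -> f 0%N x = f 0%N y) ->
  (forall s x y, L x -> L y -> f s.+1 x = f s.+1 y -> f s x = f s y) ->
  (forall s, (1 <= s)%N -> (f s @` L #<= `I_(2 ^ (2 ^ s)))%card) ->
  (forall s x y, L x -> L y -> f s x = f s y -> d x y <= delta s) ->
  (forall x, 0 <= d x x) ->
  (forall s, (N <= s)%N -> delta s = 0) ->
  \sum_(0 <= s < N) 2 `^ (s%:R / alpha%:R) * delta s <= M ->
  (gamma_functional alpha d L <= M%:E)%E.
Proof.
move=> [x0 Lx0] f0 fS fcard fdelta d0 deltaN sumM.
pose fib s x := L `&` [set y | f s y = f s x].
pose A s := [set fib s x | x in L].
have PA s : partition (A s) id L.
  split.
  - apply/seteqP; split => [x [_ [y Ly <-]] []//|x Lx].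
    by exists (fib s x) => //; exists x.
  - move=> _ _ [x Lx <-] [y Ly <-] [z [[/= Lz zx] [_ zy]]].
    by rewrite /fib -zx -zy.
  - by move=> _ [x Lx <-]; exists x.
have fibE s x : L x -> pblock (A s) id x = fib s x.
  by move=> Lx; apply: pblock_eq (PA s) _ _ => //; exists x.
have adA : admissible L A.
  split=> //.
  - move=> s _ [x Lx <-]; exists (fib s x); first by exists x.
    by move=> y [Ly fy]; split=> //; exact: fS.
  - rewrite (_ : A 0%N = [set fib 0%N x0]).
      exact: card_set1.
    apply/seteqP; split=> [_ [x Lx <-]|_ ->]; last by exists x0.
    by rewrite /fib/= (f0 x x0).
  - move=> s s1; apply: card_le_trans (fcard s s1).
    (* A block depends on its point only through the label, so there are at most as many blocks as
       labels. *)
    rewrite (_ : A s = (fun u => L `&` [set y | f s y = u]) @` (f s @` L)).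
      exact: card_image_le.
    apply/seteqP; split=> [_ [x Lx <-]|_ [_ [x Lx <-] <-]].
      by exists (f s x) => //; exists x.
    by exists x.
apply: (@le_trans _ _ (ereal_sup [set chain_sum alpha d A v | v in L])).
  by apply: ereal_inf_lbound; exists A.
apply: ge_ereal_sup => _ [v Lv <-].
have diamA s : (diameter d (pblock (A s) id v) <= (delta s)%:E)%E.
  rewrite fibE//; apply: ge_ereal_sup => _ [x [Lx xv] [y [Ly yv] <-]].
  by rewrite lee_fin fdelta// xv yv.
apply: (@le_trans _ _
  (\sum_(0 <= s <oo) (2 `^ (s%:R / alpha%:R) * delta s)%:E)%E).
  apply: lee_nneseries => s _; first by move=> _; exact: chain_term_ge0 adA Lv.
  by rewrite EFinM lee_wpmul2l// lee_fin powR_ge0.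
have delta0 s : 0 <= delta s.
  by apply: le_trans (d0 x0) _; exact: fdelta.
rewrite (nneseries_split 0%N N); last first.
  by move=> s _; rewrite lee_fin mulr_ge0 ?powR_ge0.
rewrite add0n [X in (_ + X)%E]eseries0 ?adde0; last first.
  by move=> s Ns _; rewrite deltaN// mulr0.
by rewrite sumEFin lee_fin.
Qed.

(** One single block at the levels below [N], labelled [None]; singletons from [N] on, where all
    points of [L] fit. *)
Lemma gamma_functional_le_finite (alpha : nat) d L (N : nat) (Delta : R) :
  (0 < N)%N -> L !=set0 -> (L #<= `I_(2 ^ (2 ^ N)))%card ->
  (forall x y, L x -> L y -> d x y <= Delta) -> (forall x, d x x = 0) ->
  (gamma_functional alpha d L <=
     (Delta * \sum_(0 <= s < N) 2 `^ (s%:R / alpha%:R))%:E)%E.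
Proof.
move=> N0 [x0 Lx0] cardL dL dxx.
have Delta0 : 0 <= Delta by rewrite -(dxx x0) dL.
apply: (@gamma_functional_le_chain (option T)
  (fun s x => if (s < N)%N then None else Some x)
  _ _ _ (fun s => if (s < N)%N then Delta else 0) N).
- by exists x0.
- by rewrite N0.
- move=> s x y _ _; case: ltnP => [sN _|Ns]; first by rewrite (ltnW sN).
  by move=> [->].
- move=> s s1; case: ltnP => [sN|Ns].
    apply: (@card_le_trans _ _ _ [set (None : option T)]).
      by apply: subset_card_le => _ [x _ <-].
    by rewrite (card_le_eql card_set1) card_le_II expn_gt0.
  apply: card_le_trans (card_image_le _ _) _; apply: card_le_trans cardL _.
  by rewrite card_le_II leq_pexp2l// leq_pexp2l.
- by move=> s x y Lx Ly; case: ltnP => _; [move=> _; exact: dL|move=> [->]; rewrite dxx].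
- by move=> x; rewrite dxx.
- by move=> s; rewrite leqNgt => /negbTE ->.
- rewrite mulr_sumr ler_sum_nat// => s /andP[_ ->].
  by rewrite mulrC.
Qed.

End GammaFunctional.

(** * Finite images and geometric sums of the chaining weights *)

Lemma card_image_finset (X : finType) (T : Type) (F : {set X}) (g : X -> T) :
  (g @` [set` F] #<= `I_(#|F|))%card.
Proof.
rewrite (card_le_eqr card_II).
rewrite (_ : g @` _ = (g \o enum_val) @` [set: 'I_#|F|]) ?card_image_le//.
apply/seteqP; split=> [_ [x Fx <-]|_ [i _ <-]].
  by exists (enum_rank_in Fx x) => //=; rewrite enum_rankK_in.
by exists (enum_val i) => //; exact: enum_valP.
Qed.

Lemma sum_two_powR1 {R : realType} (N : nat) :
  \sum_(0 <= s < N) (2 : R) `^ (s%:R / 1%:R) <= 2 ^+ N.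
Proof.
under eq_bigr do rewrite divr1 powR_mulrn//.
elim: N => [|N IH]; first by rewrite big_geq.
by rewrite big_nat_recr//= exprS; lra.
Qed.

Lemma sum_two_powR2 {R : realType} (N : nat) :
  \sum_(0 <= s < N) (2 : R) `^ (s%:R / 2%:R) <= 4 * Num.sqrt (2 ^+ N).
Proof.
have E s : (2 : R) `^ (s%:R / 2%:R) = Num.sqrt (2 ^+ s).
  by rewrite powRrM powR12_sqrt ?powR_ge0// powR_mulrn.
under eq_bigr do rewrite E.
(* The induction step needs 4 + 1 <= 4 sqrt 2. *)
have s2 : (5 / 4 : R) <= Num.sqrt 2.
  rewrite -(@ler_pXn2r _ 2)// ?nnegrE ?sqrtr_ge0// ?sqr_sqrtr//; lra.
elim: N => [|N IH]; first by rewrite big_geq// mulr_ge0// sqrtr_ge0.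
rewrite big_nat_recr//= exprS sqrtrM//.
have := sqrtr_ge0 ((2 : R) ^+ N); nra.
Qed.

(** * Convex hulls and rounding *)

Section ConvexHull.
Context {R : realType} {p : nat}.
Implicit Types (S : set 'rV[R]_p) (x y f : 'rV[R]_p).

Lemma sub_conv_hull S : S `<=` conv_hull S.
Proof.
move=> x Sx; exists 1%N, (fun=> 1), (fun=> x).
by split=> //; rewrite big_ord_recl big_ord0 ?addr0 ?scale1r.
Qed.

(** Reindexing by [enum_val] allows any finite index type, such as the disjoint sums used below, in
    place of the ordinals of [conv_hull]. *)
Lemma conv_hull_weighted (I : finType) S (w : I -> R) (s : I -> 'rV[R]_p) :
  (forall i, 0 <= w i) -> \sum_i w i = 1 -> (forall i, S (s i)) ->
  conv_hull S (\sum_i w i *: s i).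
Proof.
move=> w0 w1 Ss; exists #|I|, (w \o enum_val), (s \o enum_val).
split=> //=; first by rewrite -[RHS]w1 [RHS](reindex _ (onW_bij _ (@enum_val_bij I))).
by rewrite [LHS](reindex _ (onW_bij _ (@enum_val_bij I))).
Qed.

Lemma conv_hull_convex S x y (a : R) : 0 <= a -> a <= 1 ->
  conv_hull S x -> conv_hull S y -> conv_hull S (a *: x + (1 - a) *: y).
Proof.
move=> a0 a1 [m [b [u [b0 b1 Su ->]]]] [n [c [v [c0 c1 Sv ->]]]].
pose w (i : 'I_m + 'I_n) :=
  match i with inl j => a * b j | inr j => (1 - a) * c j end.
pose z (i : 'I_m + 'I_n) := match i with inl j => u j | inr j => v j end.
have -> : a *: (\sum_i b i *: u i) + (1 - a) *: (\sum_i c i *: v i) =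
    \sum_i w i *: z i.
  rewrite big_sumType/= !scaler_sumr.
  by congr (_ + _); apply: eq_bigr => i _; rewrite scalerA.
apply: conv_hull_weighted.
- by case=> j; rewrite /= mulr_ge0// subr_ge0.
- by rewrite big_sumType/= -!mulr_sumr b1 c1; lra.
- by case.
Qed.

Definition upd f i (v : R) : 'rV[R]_p := \row_j (if j == i then v else f 0 j).

Lemma sum_upd f i v :
  \sum_j upd f i v 0 j = v + \sum_(j | j != i) f 0 j.
Proof.
rewrite (bigD1 i)//= !mxE eqxx; congr (_ + _).
by apply: eq_bigr => j /negbTE ji; rewrite !mxE ji.
Qed.

Definition fractional f : {set 'I_p} := [set j | (f 0 j != 0) && (f 0 j != 1)].

(* Integrality of the polytope {f in [0,1]^p, sum f <= m}: moving mass between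
   two fractional coordinates, or rounding the last one, leaves fewer
   fractional coordinates. *)
Lemma hypersimplex_ind (m : nat) (P : 'rV[R]_p -> Prop) :
  (forall x y (a : R), 0 <= a -> a <= 1 -> P x -> P y ->
     P (a *: x + (1 - a) *: y)) ->
  (forall b : 'rV[R]_p, (forall j, b 0 j = 0 \/ b 0 j = 1) ->
     \sum_j b 0 j <= m%:R -> P b) ->
  forall f, (forall j, 0 <= f 0 j <= 1) -> \sum_j f 0 j <= m%:R -> P f.
Proof.
move=> Pconv Pint f; have [n] := ubnP #|fractional f|.
elim: n f => // n IH f; rewrite ltnS => fn f01 fm.
have [F0|[i iF]] := set_0Vmem (fractional f).
  apply: Pint => // j; have : j \notin fractional f by rewrite F0 inE.
  by rewrite inE negb_and !negbK => /orP[] /eqP; [left|right].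
have fi : 0 < f 0 i < 1.
  move: iF; rewrite inE => /andP[i0 i1]; have /andP[h0 h1] := f01 i.
  by rewrite !lt_neqAle h0 h1 i1 eq_sym i0.
have upd_frac g k v : v = 0 \/ v = 1 ->
    fractional (upd g k v) \subset fractional g :\ k.
  move=> v01; apply/fintype.subsetP => j; rewrite !inE mxE.
  by have [->|//] := eqVneq j k; case: v01 => ->; rewrite eqxx ?andbF.
have ltn_frac g k : k \in fractional f -> fractional g \subset fractional f :\ k ->
    (#|fractional g| < n)%N.
  move=> kF /subset_leq_card gk; apply: leq_ltn_trans gk _.
  by move: fn; rewrite (cardsD1 k) kF.
(* If [i] is the only fractional coordinate, [f] is the mixture, with weight f_i, of its roundings
   to 1 and to 0. *)
have [F0|[j]] := set_0Vmem (fractional f :\ i).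
  have -> : f = f 0 i *: upd f i 1 + (1 - f 0 i) *: upd f i 0.
    by apply/rowP => j; rewrite !mxE; have [->|_] := eqVneq j i; ring.
  have intE : \sum_(j | j != i) f 0 j = (\sum_(j | j != i) (f ord0 j == 1%R))%:R.
    rewrite natr_sum; apply: eq_bigr => j ji.
    have : j \notin fractional f :\ i by rewrite F0 inE.
    rewrite !inE ji/= negb_and !negbK => /orP[] /eqP ->; last by rewrite eqxx.
    by rewrite eq_sym oner_eq0.
  move: fm; rewrite (bigD1 i)//= intE => fm.
  (* The other coordinates have an integer sum, strictly below [m] because f_i > 0; this leaves room
     for rounding up to 1. *)
  have lm : (\sum_(j | j != i) (f ord0 j == 1%R) < m)%N.
    by rewrite -(ltr_nat R); lra.
  have h (v : R) : v = 0 \/ v = 1 -> P (upd f i v).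
    move=> v01; apply: IH.
    - by apply: (ltn_frac _ i) => //; exact: upd_frac.
    - by move=> j; rewrite mxE; case: eqP => // _; case: v01 => ->; rewrite ?lexx ?ler01.
    - rewrite sum_upd intE; move: lm; rewrite -(ler_nat R) -natr1.
      by case: v01 => ->; lra.
  by apply: Pconv; [lra|lra|apply: h; right|apply: h; left].
rewrite in_setD1 => /andP[ji jF].
have fj : 0 < f 0 j < 1.
  move: jF; rewrite inE => /andP[i0 i1]; have /andP[h0 h1] := f01 j.
  by rewrite !lt_neqAle h0 h1 i1 eq_sym i0.
(* With two fractional coordinates, mass [e] moves from [j] to [i], preserving the sum. *)
pose shift (e : R) := upd (upd f i (f 0 i + e)) j (f 0 j - e).
have sum_shift e : \sum_l shift e 0 l = \sum_l f 0 l.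
  have ij : i != j by rewrite eq_sym.
  rewrite sum_upd (bigD1 i ij)/= mxE eqxx [RHS](bigD1 j isT)/= [in RHS](bigD1 i ij)/=.
  rewrite [X in _ + (_ + X) = _](_ : _ = \sum_(l | (l != j) && (l != i)) f 0 l).
    by ring.
  by apply: eq_bigr => l /andP[_ /negbTE li]; rewrite mxE li.
have shift_frac e : f 0 i + e = 0 \/ f 0 i + e = 1 \/ f 0 j - e = 0 \/ f 0 j - e = 1 ->
    (#|fractional (shift e)| < n)%N.
  move=> he; have [hi|hj] : (f 0 i + e = 0 \/ f 0 i + e = 1) \/
      (f 0 j - e = 0 \/ f 0 j - e = 1) by tauto.
    apply: (ltn_frac _ i) => //; apply/fintype.subsetP => l; rewrite !inE !mxE.
    have [->|_] := eqVneq l j; first by move: jF; rewrite ji inE.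
    by have [->|_] := eqVneq l i; [case: hi => ->; rewrite eqxx ?andbF|].
  apply: (ltn_frac _ j) => //; apply/fintype.subsetP => l; rewrite !inE !mxE.
  have [->|_] := eqVneq l j; first by case: hj => ->; rewrite eqxx ?andbF.
  by have [->|_] := eqVneq l i; [move: iF; rewrite inE|].
have Pshift e : 0 <= f 0 i + e <= 1 -> 0 <= f 0 j - e <= 1 ->
    f 0 i + e = 0 \/ f 0 i + e = 1 \/ f 0 j - e = 0 \/ f 0 j - e = 1 ->
    P (shift e).
  move=> hi hj he; apply: IH; [exact: shift_frac| |by rewrite sum_shift].
  by move=> l; rewrite !mxE; case: ifP => // _; case: ifP.
(* The largest moves in either direction that stay in [0,1]: each makes coordinate [i] or [j]
   integral, and [f] lies between the two resulting points. *)
have [d1 [d10 P1]] : exists d1, 0 < d1 /\ P (shift d1).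
  have [h|h] := leP (1 - f 0 i) (f 0 j).
    exists (1 - f 0 i); split; [lra|apply: Pshift; [lra|lra|right; left; lra]].
  exists (f 0 j); split; [lra|apply: Pshift; [lra|lra|right; right; left; lra]].
have [d2 [d20 P2]] : exists d2, 0 < d2 /\ P (shift (- d2)).
  have [h|h] := leP (f 0 i) (1 - f 0 j).
    exists (f 0 i); split; [lra|apply: Pshift; [lra|lra|left; lra]].
  exists (1 - f 0 j); split; [lra|apply: Pshift; [lra|lra|right; right; right; lra]].
have dd : 0 < d1 + d2 by lra.
have -> : f = (d2 / (d1 + d2)) *: shift d1 +
              (1 - d2 / (d1 + d2)) *: shift (- d2).
  apply/rowP => l; rewrite !mxE.
  by case: eqP => [->|_]; [|case: eqP => [->|_]]; field; lra.
apply: Pconv => //; first by rewrite divr_ge0; lra.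
by rewrite ler_pdivrMr//; lra.
Qed.

End ConvexHull.

(** * Counting sparse integer vectors *)

(* With w = i^2 / 2^u >= 1: exp(7 (w - 1)) >= w^7 >= i^2 2^u. *)
Lemma expR_square_le {R : realType} (L : R) (i u : nat) :
  7 <= L -> (0 < i)%N -> (4 ^ u <= i ^ 3)%N ->
  expR (- (L / 2 ^+ u * i%:R ^+ 2)) <= expR (- L) * (i%:R ^+ 2)^-1 / 2 ^+ u.
Proof.
move=> L7 i0 iu; set w : R := i%:R ^+ 2 / 2 ^+ u.
have u0 : 0 < (2 : R) ^+ u by rewrite exprn_gt0.
have iR : 0 < (i%:R : R) by rewrite ltr0n.
have w1 : 1 <= w.
  rewrite ler_pdivlMr// mul1r -!natrX ler_nat -leq_sqr -expnM mulnC expnM.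
  by apply: leq_trans iu _; rewrite -expnM leq_pexp2l.
(* Equivalent to i^12 >= 2^(8u), the fourth power of the hypothesis. *)
have w7 : i%:R ^+ 2 * 2 ^+ u <= w ^+ 7.
  rewrite expr_div_n ler_pdivlMr ?exprn_gt0// -mulrA -!natrX -!natrM ler_nat.
  have -> : ((i ^ 2) ^ 7 = i ^ 2 * ((i ^ 3) ^ 4))%N by rewrite -!expnM -expnD.
  have -> : (2 ^ u * (2 ^ u) ^ 7 = (4 ^ u) ^ 4)%N.
    by rewrite -expnS -!expnM (_ : 4 = 2 ^ 2)%N// -expnM; congr expn; lia.
  by rewrite leq_pmul2l ?leq_exp2r// expn_gt0 i0.
have E : expR (- (L / 2 ^+ u * i%:R ^+ 2)) = expR (- L) * (expR (L * (w - 1)))^-1.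
  by rewrite -expRN -expRD; congr expR; rewrite /w; field; lra.
rewrite E -mulrA ler_pM2l ?expR_gt0// -invfM lef_pV2 ?posrE ?expR_gt0 ?mulr_gt0 ?exprn_gt0//.
apply: le_trans w7 _; apply: (@le_trans _ _ (expR (w - 1) ^+ 7)).
  rewrite lerXn2r ?nnegrE ?expR_ge0//; first by lra.
  by have := expR_ge1Dx (w - 1); lra.
by rewrite -expRM_natl ler_expR ler_wpM2r//; lra.
Qed.

Lemma sum_inv_square_le {R : realType} (n : nat) :
  \sum_(i < n) ((i.+1%:R : R) ^+ 2)^-1 <= 2.
Proof.
case: n => [|n]; first by rewrite big_ord0.
(* The strengthened bound telescopes: 1/(x+1)^2 <= 1/x - 1/(x+1). *)
suff : \sum_(i < n.+1) ((i.+1%:R : R) ^+ 2)^-1 <= 2 - n.+1%:R^-1.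
  by move=> h; apply: le_trans h _; rewrite lerBlDr lerDl invr_ge0.
elim: n => [|n IH]; first by rewrite big_ord_recl big_ord0 expr1n invr1; lra.
rewrite big_ord_recr/=; apply: le_trans (lerD IH (lexx _)) _.
have h : (0 : R) < n.+1%:R by rewrite ltr0n.
rewrite -[n.+2%:R]natr1; move: (n.+1%:R) h => x x0.
suff : ((x + 1) ^+ 2)^-1 <= x^-1 - (x + 1)^-1 by lra.
have -> : x^-1 - (x + 1)^-1 = (x * (x + 1))^-1 by field; lra.
rewrite lef_pV2 ?posrE; nra.
Qed.

Section Codes.
Context {R : realType} (p M : nat).

(** The integers of absolute value at most [M], as a finite type so that vectors can be counted:
    [None] is 0 and [Some (b, i)] is the integer i + 1 with sign [b]. *)
Definition code : Type := option (bool * 'I_M).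

Definition code_val (c : code) : R :=
  if c is Some (b, i) then (-1) ^+ b * i.+1%:R else 0.

Definition code_abs (c : code) : nat := if c is Some (_, i) then i.+1 else 0.

Lemma normr_code_val c : `|code_val c| = (code_abs c)%:R.
Proof.
by case: c => [[b i]|]; rewrite /= ?normr0// normrM normrX normrN1 expr1n mul1r normr_nat.
Qed.

Lemma sqr_code_val c : code_val c ^+ 2 = ((code_abs c) ^ 2)%:R.
Proof. by rewrite natrX -normr_code_val real_normK ?num_real. Qed.

Definition large (u : nat) (c : code) : bool :=
  (c == None) || (4 ^ u <= code_abs c ^ 3)%N.

Definition codewords (u : nat) : {set {ffun 'I_p -> code}} :=
  [set f : {ffun 'I_p -> code} |
    [forall j, large u (f j)] && (\sum_j code_abs (f j) ^ 2 <= M)%N].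

(** Zero contributes 1. The nonzero integers contribute at most exp(-L) / 2^u times the sum of
    inverse squares over both signs, which is at most 4; then 1 + x <= exp(x). *)
Lemma sum_large_weight (L : R) (u : nat) : 7 <= L ->
  \sum_(c : code | large u c) expR (- (L / 2 ^+ u * (code_abs c)%:R ^+ 2))
    <= expR (4 * expR (- L) / 2 ^+ u).
Proof.
move=> L7; have u0 : 0 < (2 : R) ^+ u by rewrite exprn_gt0.
apply: le_trans (expR_ge1Dx _).
rewrite (bigD1 None)//= expr0n/= mulr0 oppr0 expR0 lerD2l.
apply: (@le_trans _ _ (\sum_(c : code | (large u c) && (c != None))
    expR (- L) * ((code_abs c)%:R ^+ 2)^-1 / 2 ^+ u)).
  apply: ler_sum => -[[b i]|] /andP[]//= iu _.
  exact: expR_square_le.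
apply: (@le_trans _ _ (\sum_(c : code | c != None)
    expR (- L) * ((code_abs c)%:R ^+ 2)^-1 / 2 ^+ u)).
  rewrite [leLHS]big_mkcond [leRHS]big_mkcond/=; apply: ler_sum => c _.
  case: (c != None); rewrite ?andbF ?andbT//; case: ifP => // _.
rewrite -mulr_suml -mulr_sumr; apply: ler_wpM2r; first by rewrite invr_ge0 ltW.
rewrite [leRHS]mulrC.
suff : \sum_(c : code | c != None) ((code_abs c)%:R ^+ 2)^-1 <= 4 :> R.
  by apply: ler_wpM2l; exact: expR_ge0.
have -> : \sum_(c : code | c != None) ((code_abs c)%:R ^+ 2)^-1 =
    \sum_(x : bool * 'I_M) ((x.2.+1)%:R ^+ 2 : R)^-1.
  rewrite (reindex_omap (@Some _) id)/=; last by case.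
  by apply: eq_big => [x|[b i] _//]; rewrite eqxx.
rewrite -(pair_bigA _ (fun (_ : bool) (i : 'I_M) => ((i.+1)%:R ^+ 2 : R)^-1))/= big_bool/=.
by have := @sum_inv_square_le R M; lra.
Qed.

(** Exponential-moment count: since the squares sum to at most [M], each codeword has weight at
    least 1 under exp(la M) times the product of the [g (f j)]. Summed over all functions, this
    product factorizes into the p-th power of a one-coordinate sum. As p exp(-L) = k, the exponent
    is (6kL + 4k) / 2^u. *)
Lemma card_codewords_le (k : nat) (u : nat) (L : R) : (0 < k)%N -> (0 < p)%N ->
  M = (6 * k)%N -> 7 <= L -> expR L = p%:R / k%:R ->
  (#|codewords u|)%:R <= expR (10 * (k%:R * L) / 2 ^+ u).
Proof.
move=> k0 p0 Mk L7 eL; have MkR : (M%:R : R) = 6 * k%:R by rewrite Mk natrM.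
move: Mk => _; have u0 : 0 < (2 : R) ^+ u by rewrite exprn_gt0.
set la := L / 2 ^+ u; have la0 : 0 <= la by rewrite divr_ge0; lra.
pose g (c : code) : R := if large u c then expR (- (la * (code_abs c)%:R ^+ 2)) else 0.
have g0 c : 0 <= g c by rewrite /g; case: ifP => // _; exact: expR_ge0.
have kR : 0 < (k%:R : R) by rewrite ltr0n.
have pR : 0 < (p%:R : R) by rewrite ltr0n.
apply: (@le_trans _ _ (\sum_(f in codewords u)
    expR (la * M%:R) * \prod_j g (f j))).
  rewrite -sum1_card natr_sum; apply: ler_sum => f; rewrite inE => /andP[/forallP lf fM].
  under eq_bigr do rewrite /g lf.
  rewrite -expR_sum -expRD -[leLHS]expR0 ler_expR.
  rewrite sumrN -mulr_sumr -mulrBr mulr_ge0// subr_ge0.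
  move: fM; rewrite -(ler_nat R) natr_sum; congr (is_true (_ <= _)).
  by apply: eq_bigr => j _; rewrite natrX.
apply: (@le_trans _ _ (\sum_(f : {ffun 'I_p -> code})
    expR (la * M%:R) * \prod_j g (f j))).
  rewrite big_mkcond/=; apply: ler_sum => f _; case: ifP => // _.
  by rewrite mulr_ge0 ?expR_ge0// prodr_ge0.
rewrite -mulr_sumr -(bigA_distr_bigA (fun _ c => g c))/=.
rewrite prodr_const card_ord.
apply: (@le_trans _ _ (expR (la * M%:R) * expR (4 * expR (- L) / 2 ^+ u) ^+ p)).
  rewrite ler_pM2l ?expR_gt0// lerXn2r ?nnegrE ?expR_ge0 ?sumr_ge0//.
  by rewrite -big_mkcond/=; exact: sum_large_weight.
rewrite -expRM_natl -expRD ler_expR expRN eL MkR /la.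
have -> : L / 2 ^+ u * (6 * k%:R) + p%:R * (4 * (p%:R / k%:R)^-1 / 2 ^+ u) =
  (6 * (k%:R * L) + 4 * k%:R) / 2 ^+ u by field; lra.
rewrite ler_pM2r ?invr_gt0//; nra.
Qed.

End Codes.

(** * The net and its truncations *)

Section Net.
Context {R : realType} (k p : nat).
Context (k_gt0 : (0 < k)%N).

Let rk : R := Num.sqrt k%:R.

Definition decode (f : {ffun 'I_p -> code (6 * k)}) : 'rV[R]_p :=
  \row_j code_val (f j).

Definition net : set 'rV[R]_p :=
  [set (Num.sqrt k%:R)^-1 *: decode f | f in [set` codewords p (6 * k) 0]].

(** Beyond 6k, [insub] fails and the value is the default [None]; hence the bounds on [n] below. *)
Definition encode (b : bool) (n : nat) : code (6 * k) :=
  if n is i.+1 then omap (pair b) (insub i) else None.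

Lemma code_val_encode b n : (n <= 6 * k)%N ->
  code_val (encode b n) = (-1) ^+ b * n%:R :> R.
Proof.
case: n => [|n] nk; first by rewrite /= mulr0.
by rewrite /= insubT /=.
Qed.

Lemma code_abs_encode b n : (n <= 6 * k)%N -> code_abs (encode b n) = n.
Proof. by case: n => [//|n] nk; rewrite /= insubT. Qed.

Lemma large0 M (c : code M) : large 0 c.
Proof. by case: c => [[b i]|] //=; rewrite /large/= expn0 expn_gt0. Qed.

Let rk_gt0 : 0 < rk. Proof. by rewrite sqrtr_gt0 ltr0n. Qed.
Let rk2 : rk ^+ 2 = k%:R. Proof. by rewrite sqr_sqrtr. Qed.

(** The fractional parts of the |y_j|, where y = sqrt k v, sum to at most 2k, so [hypersimplex_ind]
    rounds them to 0 or 1 as a convex combination; the affine map [phi] restores integer parts,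
    signs and scale. *)
Lemma sub_conv_hull_net (v : 'rV[R]_p) :
  norm2 v <= 1 -> norm1 v <= 2 * Num.sqrt k%:R -> conv_hull net v.
Proof.
move=> v2 v1; pose y j := rk * v 0 j.
have y2 : \sum_j `|y j| ^+ 2 <= k%:R.
  under eq_bigr do rewrite real_normK ?num_real// exprMn.
  rewrite -mulr_sumr rk2 ler_piMr//.
  have s0 : 0 <= \sum_j v 0 j ^+ 2 by apply: sumr_ge0 => j _; exact: sqr_ge0.
  by rewrite -(sqr_sqrtr s0) expr_le1// sqrtr_ge0.
have y1 : \sum_j `|y j| <= (2 * k)%:R.
  under eq_bigr do rewrite normrM (gtr0_norm rk_gt0).
  rewrite -mulr_sumr natrM -rk2; have := ler_wpM2l (ltW rk_gt0) v1.
  by rewrite -/rk /norm1; nra.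
pose m j := Num.truncn `|y j|.
have mP j : (m j)%:R <= `|y j| < (m j).+1%:R by exact: truncn_itv.
pose phi (f : 'rV[R]_p) : 'rV[R]_p :=
  rk^-1 *: \row_j ((-1) ^+ (y j < 0)%R * ((m j)%:R + f 0 j)).
have -> : v = phi (\row_j (`|y j| - (m j)%:R)).
  apply/rowP => j; rewrite !mxE addrC subrK -numEsign.
  by rewrite mulKf ?gt_eqF.
apply: (@hypersimplex_ind _ _ (2 * k) (fun f => conv_hull net (phi f))).
- move=> f g a a0 a1 Pf Pg.
  have -> : phi (a *: f + (1 - a) *: g) = a *: phi f + (1 - a) *: phi g.
    by apply/rowP => j; rewrite !mxE; ring.
  exact: conv_hull_convex.
- move=> b b01 bk; apply: sub_conv_hull.
  pose n j := (m j + (b ord0 j == 1%R))%N.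
  have nE j : (n j)%:R = (m j)%:R + b 0 j :> R.
    by rewrite natrD; case: (b01 j) => ->; rewrite ?eqxx// eq_sym oner_eq0.
  (* From (m + b)^2 <= 2 m^2 + 2 b for b in {0,1}, the sum is at most 2k + 4k. *)
  have n2 : (\sum_j n j ^ 2 <= 6 * k)%N.
    rewrite -(ler_nat R) natr_sum.
    apply: (@le_trans _ _ (\sum_j (2 * `|y j| ^+ 2 + 2 * b 0 j))).
      apply: ler_sum => j _; rewrite natrX nE.
      have /andP[h _] := mP j; have m0 : 0 <= (m j)%:R :> R by [].
      have m2 : (m j)%:R ^+ 2 <= `|y j| ^+ 2 by rewrite lerXn2r ?nnegrE.
      move: (b 0 j) (b01 j) m2 => c c01; move: ((m j)%:R) (`|y j| ^+ 2) => a d ad.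
      by case: c01 => ->; have := sqr_ge0 d; have := sqr_ge0 (a - 1); have := sqr_ge0 a; nra.
    rewrite big_split/= -!mulr_sumr natrM; move: bk; rewrite natrM; lra.
  have nk j : (n j <= 6 * k)%N.
    apply: leq_trans n2; rewrite (bigD1 j)//=; apply: leq_trans (leq_addr _ _).
    by case: (n j) => // l; rewrite -[leqLHS]expn1 leq_pexp2l.
  exists [ffun j => encode (y j < 0)%R (n j)].
    rewrite /= inE; apply/andP; split; first by apply/forallP => j; exact: large0.
    by under eq_bigr do rewrite ffunE code_abs_encode//.
  congr (_ *: _); apply/rowP => j.
  by rewrite !mxE ffunE code_val_encode// nE.
- move=> j; rewrite mxE; have /andP[h1 h2] := mP j; rewrite -natr1 in h2.
  by apply/andP; split; lra.
- apply: le_trans y1; apply: ler_sum => j _; rewrite mxE.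
  by rewrite gerBl.
Qed.

Lemma net_sqr (x : 'rV[R]_p) : net x -> \sum_j x 0 j ^+ 2 <= 6.
Proof.
move=> [f] /=; rewrite inE => /andP[_ fk] <-.
under eq_bigr do rewrite !mxE exprMn sqr_code_val.
rewrite -mulr_sumr -natr_sum exprVn rk2 mulrC ler_pdivrMr ?ltr0n//.
by rewrite -natrM ler_nat.
Qed.

Lemma net_dist2 (x y : 'rV[R]_p) : net x -> net y -> norm2 (x - y) <= 5.
Proof.
move=> /net_sqr xs /net_sqr ys; rewrite /norm2.
(* The squared distance is at most 2 * 6 + 2 * 6 = 24 < 25. *)
have -> : (5 : R) = Num.sqrt (5 ^+ 2) by rewrite sqrtr_sqr ger0_norm.
apply: ler_wsqrtr.
apply: (@le_trans _ _ (\sum_j (2 * x 0 j ^+ 2 + 2 * y 0 j ^+ 2))).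
  by apply: ler_sum => j _; rewrite !mxE; have := sqr_ge0 (x 0 j + y 0 j); nra.
by rewrite big_split/= -!mulr_sumr; lra.
Qed.

Lemma net0 : net 0.
Proof.
exists [ffun=> None].
  rewrite /= inE; apply/andP; split; first by apply/forallP => j; rewrite ffunE.
  by rewrite big1// => j _; rewrite ffunE.
rewrite (_ : decode _ = 0) ?scaler0//; apply/rowP => j.
by rewrite !mxE ffunE.
Qed.

(* The threshold 4^(u/3) lies between 2^(u/2), needed for at most
   exp(O(kL / 2^u)) truncations, and 2^u, where the chaining sum diverges. *)
Definition truncate (u : nat) (x : 'rV[R]_p) : 'rV[R]_p :=
  \row_j (if (4 ^ u)%:R <= `|x 0 j| ^+ 3 then x 0 j else 0).

(** Coarser truncations factor through finer ones, which makes the partitions of the chain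
    nested. *)
Lemma truncate_truncate u v (x : 'rV[R]_p) : (u <= v)%N ->
  truncate v (truncate u x) = truncate v x.
Proof.
move=> uv; apply/rowP => j; rewrite !mxE.
case: (leP (4 ^ u)%:R) => // xu; rewrite if_same; case: leP => // vx.
suff : (4 ^ u)%:R <= `|x 0 j| ^+ 3 by rewrite leNgt xu.
by apply: le_trans vx; rewrite ler_nat leq_pexp2l.
Qed.

Lemma truncate_decode u f : f \in codewords p (6 * k) 0 ->
  exists2 g, g \in codewords p (6 * k) u & truncate u (decode f) = decode g.
Proof.
rewrite inE => /andP[_ fk].
exists [ffun j => if large u (f j) then f j else None]; last first.
  apply/rowP => j; rewrite !mxE !ffunE normr_code_val -natrX ler_nat.
  by rewrite /large; case: (f j) => [[b i]|] /=; case: ifP.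
rewrite inE; apply/andP; split.
  by apply/forallP => j; rewrite ffunE; case: ifP.
apply: leq_trans fk; apply: leq_sum => j _; rewrite ffunE.
by case: ifP => // _; rewrite exp0n.
Qed.

Lemma truncate_net_subset u :
  (fun x => truncate u (Num.sqrt k%:R *: x)) @` net `<=`
    decode @` [set` codewords p (6 * k) u].
Proof.
move=> _ [_ [f /= f0 <-] <-].
rewrite scalerA divff ?gt_eqF// scale1r.
by have [g gu ->] := truncate_decode u f0; exists g.
Qed.

Lemma card_truncate_net u :
  ((fun x => truncate u (Num.sqrt k%:R *: x)) @` net #<=
    `I_(#|codewords p (6 * k) u|))%card.
Proof.
apply: (@card_le_trans _ _ _ (decode @` [set` codewords p (6 * k) u])).
  exact/subset_card_le/truncate_net_subset.
exact: card_image_finset.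
Qed.

(** Nonzero integers pass the threshold 4^0 = 1, so level 0 separates the points of the net. *)
Lemma truncate0_net x : net x -> truncate 0 (Num.sqrt k%:R *: x) = Num.sqrt k%:R *: x.
Proof.
move=> [f _ <-]; rewrite scalerA divff ?gt_eqF// scale1r.
apply/rowP => j; rewrite !mxE expn0 normr_code_val -natrX ler_nat.
by case: (f j) => [[b i]|] //=; rewrite expn_gt0.
Qed.

(** Kept coordinates are nonzero, so equal truncations keep the same ones, with equal values.
    Discarded ones are at most (8/5)^u in absolute value, since 4 <= (8/5)^3. *)
Lemma truncate_coord u (x y : 'rV[R]_p) j :
  truncate u x = truncate u y -> `|x 0 j - y 0 j| <= 2 * (8 / 5) ^+ u.
Proof.
move=> /rowP/(_ j); rewrite !mxE.
have e0 : 0 < (8 / 5 : R) ^+ u by rewrite exprn_gt0.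
have small (z : R) : ((4 ^ u)%:R <= `|z| ^+ 3) = false -> `|z| <= (8 / 5 : R) ^+ u.
  move=> /negbT/negP zu; rewrite leNgt; apply/negP => h; apply: zu.
  apply: (@le_trans _ _ (((8 / 5) ^+ u) ^+ 3)); last first.
    by rewrite lerXn2r ?nnegrE ?normr_ge0 ?(ltW e0) ?(ltW h).
  by rewrite exprAC natrX lerXn2r ?nnegrE//; lra.
have big z : (4 ^ u)%:R <= `|z| ^+ 3 -> z <> 0 :> R.
  move=> + z0; rewrite z0 normr0 expr0n/= leNgt => /negP; apply.
  by rewrite ltr0n expn_gt0.
case: ifP => hx; case: ifP => hy.
- by move=> ->; rewrite subrr normr0 mulr_ge0// ltW.
- by move=> xy; have := big _ hx xy.
- by move=> /esym xy; have := big _ hy xy.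
- move=> _; apply: le_trans (ler_normB _ _) _.
  by have := small _ hx; have := small _ hy; lra.
Qed.

End Net.

(** * Gamma-functionals of the net *)

Lemma exists_exp2_between {R : realType} (x : R) : 1 < x ->
  exists s, [/\ (0 < s)%N, x <= 2 ^+ s & 2 ^+ s <= 2 * x].
Proof.
move=> x1.
have ex : exists n, x <= (2 ^ n)%:R.
  exists (Num.truncn x).+1; apply: ltW; apply: lt_trans (truncnS_gt x) _.
  by rewrite ltr_nat ltn_expl.
case: (ex_minnP ex) => -[|m] xm mmin; first by move: xm; rewrite expn0; lra.
exists m.+1; split => //; first by rewrite -natrX.
rewrite exprS ler_pM2l//; rewrite leNgt; apply/negP => /ltW h.
by have := mmin m; rewrite natrX h ltnn => /(_ isT).
Qed.

(** It suffices that exp(1/2) <= 2, which follows from 1 - 1/2 <= exp(-1/2). *)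
Lemma leq_exp2_exp2 {R : realType} (N s : nat) :
  N%:R <= expR (2 ^+ s / 2) :> R -> (N <= 2 ^ (2 ^ s))%N.
Proof.
move=> h; rewrite -(ler_nat R); apply: le_trans h _.
have e2 : expR (2^-1) <= 2 :> R.
  rewrite -[leLHS]invrK -expRN -[leRHS]invrK lef_pV2 ?posrE ?invr_gt0 ?expR_gt0//.
  by have := expR_ge1Dx (- 2^-1 : R); lra.
rewrite -natrX expRM_natl natrX lerXn2r// ?nnegrE ?expR_ge0//.
Qed.

Lemma norm_infty_le {R : realType} (p : nat) (v : 'rV[R]_p) (c : R) :
  0 <= c -> (forall j, `|v 0 j| <= c) -> norm_infty v <= c.
Proof.
move=> c0 vc; rewrite /norm_infty /Num.norm/= mx_normrE.
by apply: bigmax_le => // -[i j] _; rewrite ord1.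
Qed.

Lemma norm2_subrr {R : realType} (p : nat) (x : 'rV[R]_p) : norm2 (x - x) = 0.
Proof.
by rewrite subrr /norm2 big1 ?sqrtr0// => j _; rewrite mxE expr0n.
Qed.

Lemma norm_infty_subrr {R : realType} (p : nat) (x : 'rV[R]_p) : norm_infty (x - x) = 0.
Proof. by rewrite subrr /norm_infty normr0. Qed.

Lemma normr_coord_le {R : realType} (p : nat) (v : 'rV[R]_p) j : `|v 0 j| <= norm2 v.
Proof.
rewrite -sqrtr_sqr; apply: ler_wsqrtr; rewrite (bigD1 j)//= lerDl.
by apply: sumr_ge0 => i _; exact: sqr_ge0.
Qed.

(** The terms are 2^n (4/5)^(n-s) with n - s >= 1, and the powers (4/5)^i with i >= 1 sum to 4. *)
Lemma sum_geometric_mix {R : realType} (n : nat) :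
  \sum_(0 <= s < n) (2 : R) ^+ s * (8 / 5) ^+ (n - s) <= 4 * 2 ^+ n.
Proof.
elim: n => [|n IH]; first by rewrite big_geq// mulr_ge0.
rewrite big_nat_recr//= subSn// subnn expr1.
under eq_big_nat => s /andP[_ sn] do rewrite subSn 1?ltnW// exprS mulrCA.
rewrite -mulr_sumr exprS; have : 0 < (2 : R) ^+ n by rewrite exprn_gt0.
by lra.
Qed.

Section GammaNet.
Context {R : realType} (k p : nat) (L : R).
Context (k_gt0 : (0 < k)%N) (p_gt0 : (0 < p)%N).
Hypotheses (L_ge7 : 7 <= L) (expRL : expR L = p%:R / k%:R).

Let kR : 1 <= k%:R :> R. Proof. by rewrite ler1n. Qed.

(** With 2^s0 >= 20 kL, the exp(10 kL / 2^u) truncations of level [u] number at most exp(2^(s0-u) /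
    2), hence fit into the partition of level s0 - u. *)
Lemma net_scale : exists s0, [/\ (0 < s0)%N, 2 ^+ s0 <= 40 * (k%:R * L) &
  forall u s, (u <= s0)%N -> (s0 - u <= s)%N ->
    ((fun x => truncate u (Num.sqrt k%:R *: x)) @` @net R k p #<= `I_(2 ^ (2 ^ s)))%card].
Proof.
have [|s0 [s00 s01 s02]] := @exists_exp2_between R (20 * (k%:R * L)).
  have : 1 * 7 <= k%:R * L by apply: ler_pM.
  by lra.
exists s0; split => //; first by lra.
move=> u s us0 us.
apply: card_le_trans (card_truncate_net p k_gt0 u) _; rewrite card_le_II.
apply: (@leq_trans (2 ^ (2 ^ (s0 - u)))); last by rewrite leq_pexp2l// leq_pexp2l.
apply: (@leq_exp2_exp2 R).
apply: le_trans (card_codewords_le u k_gt0 p_gt0 erefl L_ge7 expRL) _.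
rewrite ler_expR expfB_cond; last by rewrite pnatr_eq0.
rewrite [leRHS]mulrAC; apply: ler_wpM2r; first by rewrite invr_ge0 exprn_ge0.
by lra.
Qed.

(** The diameter 5 at every level below [s0] is good enough: 5 * 4 sqrt(2^s0) <= 20 sqrt 40
    sqrt(kL), and sqrt 40 <= 7. *)
Lemma gamma2_net_le :
  (gamma 2 norm2 (@net R k p) <= (140 * Num.sqrt (k%:R * L))%:E)%E.
Proof.
have [s0 [s00 s02 card]] := net_scale.
apply: (@le_trans _ _ (5 * \sum_(0 <= s < s0) (2 : R) `^ (s%:R / 2%:R))%:E); last first.
  have H0 : 0 <= k%:R * L by apply: mulr_ge0 => //; apply: le_trans L_ge7.
  rewrite lee_fin; have := @sum_two_powR2 R s0; have := ler_wsqrtr s02.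
  have s49 : Num.sqrt 40 <= 7 :> R.
    have -> : (7 : R) = Num.sqrt (7 ^+ 2) by rewrite sqrtr_sqr ger0_norm.
    by apply: ler_wsqrtr; lra.
  rewrite sqrtrM//; have := sqrtr_ge0 (k%:R * L).
  move: (Num.sqrt (k%:R * L)) (Num.sqrt 40) s49 => a b b7 a0.
  have := ler_wpM2r a0 b7; lra.
apply: gamma_functional_le_finite => //.
- by exists 0; exact: net0.
- have := card 0%N s0 isT; rewrite subn0 leqnn => /(_ isT); apply: card_le_trans.
  rewrite (_ : _ @` _ = (fun x => Num.sqrt k%:R *: x) @` @net R k p).
    apply: card_le_trans (subset_card_le _) (card_image_le
      (fun x => (Num.sqrt k%:R)^-1 *: x) _).
    move=> x nx; exists (Num.sqrt k%:R *: x); first by exists x.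
    by rewrite scalerA mulVf ?scale1r// gt_eqF// sqrtr_gt0 ltr0n.
  by apply: eq_imagel => x /(truncate0_net k_gt0).
- by move=> x y nx ny; exact: (net_dist2 k_gt0 nx ny).
- exact: norm2_subrr.
Qed.

(** Level s > 0 is labelled by the truncation of level s0 - s, so the chain refines as the threshold
    falls. The sum is at most 5 + 320 sqrt k L, the 5 coming from level 0. *)
Lemma gamma1_net_le :
  (gamma 1 norm_infty (@net R k p) <= (325 * (Num.sqrt k%:R * L))%:E)%E.
Proof.
have [s0 [s00 s02 card]] := net_scale.
have rk0 : 0 < Num.sqrt k%:R :> R by rewrite sqrtr_gt0 ltr0n.
have rk1 : 1 <= Num.sqrt k%:R :> R by rewrite -[leLHS]sqrtr1 ler_wsqrtr.
apply: (@gamma_functional_le_chain _ _ _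
  (fun s x => if s == 0%N then 0 else truncate (s0 - s) (Num.sqrt k%:R *: x))
  _ _ _ (fun s => if s == 0%N then 5 else
    if (s < s0)%N then 2 * (8 / 5) ^+ (s0 - s) / Num.sqrt k%:R else 0) s0).
- by exists 0; exact: net0.
- by [].
- move=> [//|s] x y _ _ /= xy.
  have le : (s0 - s.+2 <= s0 - s.+1)%N by rewrite leq_sub2l.
  rewrite -(truncate_truncate _ le) -[RHS](truncate_truncate _ le).
  by rewrite xy.
- move=> [//|s] _ /=; apply: card; first exact: leq_subr.
  by lia.
- move=> s x y nx ny; case: ifP => _.
    move=> _; apply: norm_infty_le => // j.
    exact: le_trans (normr_coord_le _ _) (net_dist2 k_gt0 nx ny).
  case: ltnP => ss0 xy.
    apply: norm_infty_le => [|j]; first by rewrite !mulr_ge0 ?exprn_ge0 ?invr_ge0// ltW.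
    have := truncate_coord j xy; rewrite !mxE -mulrBr normrM (gtr0_norm rk0).
    by rewrite ler_pdivlMr// mulrC.
  (* From [s0] on the subtraction gives truncation level 0, so equal labels force equal points. *)
  move: xy; rewrite (_ : s0 - s = 0)%N; last by apply/eqP; rewrite subn_eq0.
  rewrite !truncate0_net// => /(congr1 (fun x => (Num.sqrt k%:R)^-1 *: x)).
  by rewrite !scalerA mulVf ?gt_eqF// !scale1r => ->; rewrite norm_infty_subrr.
- by move=> x; rewrite norm_infty_subrr.
- move=> s s0s; case: eqP s0s => [->|_]; first by rewrite leqn0 => /eqP s0E; move: s00; rewrite s0E.
  by rewrite leqNgt => /negbTE->.
- rewrite big_ltn//= mul0r powRr0 mul1r.
  apply: (@le_trans _ _ (5 + \sum_(1 <= s < s0)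
      2 / Num.sqrt k%:R * (2 ^+ s * (8 / 5) ^+ (s0 - s)))).
    rewrite lerD2l ler_sum_nat// => s /andP[s1 ss0].
    rewrite gtn_eqF// ss0 divr1 powR_mulrn//.
    by rewrite le_eqVlt; apply/orP; left; apply/eqP; field; rewrite gt_eqF.
  rewrite -mulr_sumr.
  have : \sum_(1 <= s < s0) (2 : R) ^+ s * (8 / 5) ^+ (s0 - s) <= 4 * 2 ^+ s0.
    apply: le_trans (sum_geometric_mix s0); rewrite [leRHS]big_ltn// lerDr.
    by rewrite mulr_ge0 ?exprn_ge0.
  move=> h; have rk' : 0 <= 2 / Num.sqrt k%:R :> R by rewrite divr_ge0 ?ltW.
  apply: (@le_trans _ _ (5 + 2 / Num.sqrt k%:R * (160 * (k%:R * L)))).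
    by rewrite lerD2l ler_wpM2l//; lra.
  have -> : 2 / Num.sqrt k%:R * (160 * (k%:R * L)) = 320 * (Num.sqrt k%:R * L).
    have -> : k%:R * L = Num.sqrt k%:R ^+ 2 * L by rewrite sqr_sqrtr.
    by field; rewrite gt_eqF.
  have : 1 * 7 <= Num.sqrt k%:R * L by apply: ler_pM.
  by lra.
Qed.

End GammaNet.

(** * The cross-polytope and the descent cone *)

Section CrossPolytope.
Context {R : realType} (p : nat) (r : R).
Context (r_gt0 : 0 < r).

(** The origin is included as [None]: it absorbs the slack in convex combinations and covers the
    point 0 required by the m-complexities. *)
Definition cross_vertex (c : option (bool * 'I_p)) : 'rV[R]_p :=
  if c is Some (b, j) then (r * (-1) ^+ b) *: delta_mx 0 j else 0.

Definition cross_polytope : set 'rV[R]_p := range cross_vertex.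

Lemma card_cross_polytope : (cross_polytope #<= `I_((2 * p).+1))%card.
Proof.
have -> : ((2 * p).+1 = #|[set: option (bool * 'I_p)]%SET|)%N.
  by rewrite cardsT card_option card_prod card_bool card_ord.
rewrite (_ : cross_polytope = cross_vertex @` [set` [set: option (bool * 'I_p)]%SET]).
  exact: card_image_finset.
by congr (_ @` _); apply/seteqP; split=> c //= _; rewrite inE.
Qed.

Lemma cross_vertex_sqr c : \sum_j cross_vertex c 0 j ^+ 2 <= r ^+ 2.
Proof.
case: c => [[b i]|] /=; last first.
  by rewrite big1 ?sqr_ge0// => j _; rewrite mxE expr0n.
rewrite (bigD1 i)//= big1 ?addr0.
  by rewrite !mxE !eqxx mulr1 exprMn sqrr_sign mulr1.
by move=> j ji; rewrite !mxE (negbTE ji) andbF mulr0 expr0n.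
Qed.

Lemma cross_polytope_dist2 x y :
  cross_polytope x -> cross_polytope y -> norm2 (x - y) <= 2 * r.
Proof.
move=> [c _ <-] [d _ <-]; rewrite /norm2.
have -> : 2 * r = Num.sqrt ((2 * r) ^+ 2) by rewrite sqrtr_sqr ger0_norm// mulr_ge0// ltW.
apply: ler_wsqrtr; set x' := cross_vertex c; set y' := cross_vertex d.
apply: (@le_trans _ _ (\sum_j (2 * x' 0 j ^+ 2 + 2 * y' 0 j ^+ 2))).
  by apply: ler_sum => j _; rewrite !mxE; have := sqr_ge0 (x' 0 j + y' 0 j); nra.
rewrite big_split/= -!mulr_sumr.
by have := cross_vertex_sqr c; have := cross_vertex_sqr d; rewrite -/x' -/y'; nra.
Qed.

Lemma sub_conv_hull_cross_polytope (v : 'rV[R]_p) :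
  norm1 v <= r -> conv_hull cross_polytope v.
Proof.
move=> vr.
pose w (i : 'I_1 + 'I_p) := match i with
  | inl _ => 1 - norm1 v / r | inr j => `|v 0 j| / r end.
pose s (i : 'I_1 + 'I_p) := cross_vertex (match i with
  | inl _ => None | inr j => Some ((v 0 j < 0)%R, j) end).
have -> : v = \sum_i w i *: s i.
  rewrite big_sumType/= big_ord1 scaler0 add0r {1}[v]row_sum_delta.
  apply: eq_bigr => j _; rewrite scalerA; congr (_ *: _).
  by rewrite {1}[v 0 j]numEsign; field; rewrite gt_eqF.
apply: conv_hull_weighted.
- case=> j /=; last by rewrite divr_ge0// ltW.
  by rewrite subr_ge0 ler_pdivrMr// mul1r.
- by rewrite big_sumType/= big_ord1 -mulr_suml -/(norm1 v) subrK.
- by move=> i; exists (match i with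
  | inl _ => None | inr j => Some ((v 0 j < 0)%R, j) end).
Qed.

(** The 2p + 1 points fit at level [s] because 2p + 1 <= (2p)^2 and 2^s >= 4 ln(2p); then 2^s <= 8
    ln(2p) gives 2r * 8 ln(2p). *)
Lemma gamma1_cross_polytope_le : (0 < p)%N -> 1 <= ln (2 * p%:R) :> R ->
  (gamma 1 norm2 cross_polytope <= (16 * (r * ln (2 * p%:R)))%:E)%E.
Proof.
move=> p0 l1; have [|s [s0 s1 s2]] := @exists_exp2_between R (4 * ln (2 * p%:R)).
  by lra.
apply: (@le_trans _ _ (2 * r * \sum_(0 <= i < s) (2 : R) `^ (i%:R / 1%:R))%:E).
  apply: gamma_functional_le_finite => //.
  - by exists (cross_vertex None), None.
  - apply: card_le_trans card_cross_polytope _; rewrite card_le_II.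
    apply: (@leq_exp2_exp2 R).
    apply: (@le_trans _ _ (expR (2 * ln (2 * p%:R)))); last first.
      by rewrite ler_expR; lra.
    have p1 : 1 <= p%:R :> R by rewrite ler1n.
    rewrite expRM_natl lnK ?posrE; last by lra.
    by rewrite -natr1 natrM; nra.
  - exact: cross_polytope_dist2.
  - exact: norm2_subrr.
rewrite lee_fin; have h := @sum_two_powR1 R s.
apply: (@le_trans _ _ (2 * r * (8 * ln (2 * p%:R)))); last by lra.
apply: ler_wpM2l; first by rewrite mulr_ge0// ltW.
by apply: le_trans h _; lra.
Qed.

End CrossPolytope.

Section DescentCone.
Context {R : realType} {p : nat} (beta : 'rV[R]_p).

(* [phi] is a sublinear minorant of [h |-> norm1 (beta + h) - norm1 beta], so
   it is nonpositive on the descent cone of [norm1] at [beta]. *)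
Let phi (h : 'rV[R]_p) (j : 'I_p) : R :=
  if beta 0 j == 0 then `|h 0 j| else Num.sg (beta 0 j) * h 0 j.

Let phiZ (a : R) h j : 0 <= a -> phi (a *: h) j = a * phi h j.
Proof.
by move=> a0; rewrite /phi !mxE; case: ifP => _; [rewrite normrM ger0_norm|ring].
Qed.

Let phiD h g j : phi (h + g) j <= phi h j + phi g j.
Proof. by rewrite /phi !mxE; case: ifP => _; [exact: ler_normD|rewrite mulrDr]. Qed.

Definition descent_cone : set 'rV[R]_p := [set h | \sum_j phi h j <= 0].

Lemma descent_coneZ (a : R) h : 0 <= a -> descent_cone h -> descent_cone (a *: h).
Proof.
move=> a0 h0; rewrite /descent_cone/=; under eq_bigr do rewrite phiZ//.
by rewrite -mulr_sumr mulr_ge0_le0.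
Qed.

Lemma descent_coneD h g : descent_cone h -> descent_cone g -> descent_cone (h + g).
Proof.
move=> h0 g0; apply: le_trans (ler_sum _ (fun j _ => phiD h g j)) _.
by rewrite big_split/=; move: h0 g0; rewrite /descent_cone/=; lra.
Qed.

Lemma descent_cone0 : descent_cone 0.
Proof.
rewrite /descent_cone/= big1// => j _.
by rewrite /phi !mxE normr0 mulr0 if_same.
Qed.

(** Coordinatewise, [phi] at x - beta is at most |x_j| - |beta_j|, the subgradient inequality. *)
Lemma descent_cone_sub x : norm1 x <= norm1 beta -> descent_cone (x - beta).
Proof.
rewrite -subr_le0 /norm1 -sumrB; apply: le_trans; apply: ler_sum => j _.
rewrite /phi !mxE; case: eqP => [->|_]; first by rewrite normr0 !subr0.
rewrite mulrBr -normrEsg lerD2r; apply: le_trans (ler_norm _) _.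
by rewrite normrM ler_piMl// normr_sg lern1 leq_b1.
Qed.

(** The descent cone is a convex cone, hence closed under the conic hull (t = 0) and under scaling
    by 1/t. *)
Lemma localized_descent_cone (t : R) (D : set 'rV[R]_p) : 0 <= t ->
  D `<=` descent_cone -> localized t D `<=` descent_cone `&` @sphere R p.
Proof.
move=> t0 Dcone v [+ sv]; case: ifP => [_|_].
  move=> [m [a [x [a0 Dx vE]]]]; split=> //; rewrite vE.
  elim/big_ind: _ => [|h g|i _]; [exact: descent_cone0|exact: descent_coneD|].
  by apply: descent_coneZ => //; exact: Dcone.
move=> [x Dx xv]; split=> //; rewrite -xv.
by apply: descent_coneZ; [rewrite invr_ge0|exact: Dcone].
Qed.

(** Off the support |v_j| equals [phi v j], on it [phi v j] is at least -|v_j|. Summing the bound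
    [amgm] gives at most 0 + r + k/r = 2r for r = sqrt k. *)
Lemma descent_cone_norm1 (k : nat) v : (0 < k)%N -> sparse k beta ->
  descent_cone v -> norm2 v = 1 -> norm1 v <= 2 * Num.sqrt k%:R.
Proof.
move=> k0 bk; rewrite /descent_cone/= => v0 v1.
set r : R := Num.sqrt k%:R; have r0 : 0 < r by rewrite sqrtr_gt0 ltr0n.
have v2 : \sum_j v 0 j ^+ 2 = 1.
  rewrite -[RHS](expr1n _ 2) -v1 sqr_sqrtr//.
  by apply: sumr_ge0 => j _; exact: sqr_ge0.
pose supp j : R := (beta ord0 j != 0)%:R.
have supp_sum : \sum_j supp j <= r ^+ 2.
  rewrite -natr_sum sqr_sqrtr// ler_nat; apply: leq_trans bk.
  by rewrite -sum1_card [leqRHS]big_mkcond; apply: leq_sum => j _; rewrite inE; case: ifP.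
(* AM-GM: 2 |v_j| <= r v_j^2 + 1 / r *)
have amgm j : `|v 0 j| <= phi v j + r * v 0 j ^+ 2 + r^-1 * supp j.
  have k1 : 2 * `|v 0 j| <= r * v 0 j ^+ 2 + r^-1.
    rewrite -subr_ge0 (_ : _ - _ = r * (`|v 0 j| - r^-1) ^+ 2).
      by rewrite mulr_ge0 ?sqr_ge0// ltW.
    by rewrite -(@real_normK _ (v 0 j)) ?num_real//; field; rewrite gt_eqF.
  have rv : 0 <= r * v 0 j ^+ 2 by rewrite mulr_ge0 ?sqr_ge0// ltW.
  rewrite /phi /supp; case: eqP => [_|/eqP b0] /=; first by lra.
  suff : - `|v 0 j| <= Num.sg (beta 0 j) * v 0 j by rewrite mulr1; lra.
  rewrite lerNl; apply: le_trans (ler_norm _) _.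
  by rewrite normrN normrM ler_piMl// normr_sg lern1 leq_b1.
apply: le_trans (ler_sum _ (fun j _ => amgm j)) _.
rewrite !big_split/= -!mulr_sumr v2.
have : r^-1 * \sum_j supp j <= r^-1 * r ^+ 2 by rewrite ler_wpM2l// invr_ge0 ltW.
by rewrite [X in _ <= X](_ : _ = r); [lra|field; rewrite gt_eqF].
Qed.

End DescentCone.

(** * Comparison of the complexities *)

Section Complexities.
Context {R : realType} {p : nat}.
Implicit Types (F G : set 'rV[R]_p -> \bar R) (t C : R) (D S : set 'rV[R]_p).

Lemma q_complexity_le F G t C D : 0 < C ->
  (forall S, (F S <= C%:E * G S)%E) ->
  (q_complexity F t D <= C%:E * m_complexity G t D)%E.
Proof.
move=> C0 FG; rewrite -lee_pdivrMl//; apply: le_ereal_inf_tmp => _ [S DS <-].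
rewrite lee_pdivrMl//; apply: le_trans (FG S).
by apply: ereal_inf_lbound; exists S => // v Dv; apply: DS; left.
Qed.

Lemma m_complexity_le F t D S : localized t D `|` [set 0] `<=` conv_hull S ->
  (m_complexity F t D <= F S)%E.
Proof. by move=> DS; apply: ereal_inf_lbound; exists S. Qed.

Lemma gamma_norm2_ge0 alpha S : (0 <= gamma alpha norm2 S)%E.
Proof. by apply: gamma_functional_ge0 => x; rewrite norm2_subrr. Qed.

Lemma gamma_norm_infty_ge0 alpha S : (0 <= gamma alpha norm_infty S)%E.
Proof. by apply: gamma_functional_ge0 => x; rewrite norm_infty_subrr. Qed.

Lemma gamma2_norm2_le S : (gamma 2 norm2 S <= gamma 1 norm2 S)%E.
Proof. by apply: gamma_functional2_le1 => x; rewrite norm2_subrr. Qed.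

Lemma lee_inv_sqrt_natM (n : nat) (x : \bar R) : (0 < n)%N -> (0 <= x)%E ->
  (((Num.sqrt n%:R)^-1)%:E * x <= x)%E.
Proof.
move=> n0 x0; rewrite -[leRHS]mul1e; apply: lee_wpmul2r => //.
rewrite lee_fin invf_le1 ?sqrtr_gt0 ?ltr0n//.
by rewrite -[leLHS]sqrtr1 ler_wsqrtr// ler1n.
Qed.

Lemma lee_natMl C (x : \bar R) : 1 <= C -> (0 <= x)%E -> (x <= C%:E * x)%E.
Proof. by move=> C1 x0; rewrite -[leLHS]mul1e; apply: lee_wpmul2r. Qed.

End Complexities.

Theorem proposition3p12 (R : realType) :
  exists c0 C : R, [/\ 0 < c0, c0 < 1, 0 < C &
    forall (t : R) (n k p : nat) (beta : 'rV[R]_p),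
      0 <= t -> (0 < n)%N -> (0 < k)%N -> (0 < p)%N ->
      k%:R <= c0 * p%:R ->
      sparse k beta ->
      let K := [set norm1 beta *: x | x in @l1_ball R p] in
      let D := [set x - beta | x in K] in
      [/\ (q_2_0 t n D <= C%:E * m_2_0 t D)%E /\
          (m_2_0 t D <= (C * Num.sqrt (k%:R * ln (p%:R / k%:R)))%:E)%E,
          (q_2_infty t n D <= C%:E * m_2_infty t D)%E /\
          (m_2_infty t D <=
             (C * Num.sqrt (k%:R * ln (p%:R / k%:R) * ln p%:R))%:E)%E
        & (q_0_2 t n D <= C%:E * m_0_2 t D)%E /\
          (m_0_2 t D <= (C * (Num.sqrt k%:R * ln (2 * p%:R)))%:E)%E]].
Proof.
(* The choice of c0 gives ln(p/k) >= 7, as the counting requires; 465 = 325 + 140 adds the two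
   bounds on the net. *)
exists (expR (- 7)), 465; split; [exact: expR_gt0|by rewrite expR_lt1; lra|by rewrite ltr0n|].
have C0 : 0 < 465 :> R by rewrite ltr0n.
move=> t n k p beta t0 n0 k0 p0 kp bk K D.
have kR : 1 <= k%:R :> R by rewrite ler1n.
have pR : 1 <= p%:R :> R by rewrite ler1n.
have kgt0 : 0 < k%:R :> R by rewrite ltr0n.
have pgt0 : 0 < p%:R :> R by rewrite ltr0n.
set L : R := ln (p%:R / k%:R).
have eL : expR L = p%:R / k%:R by rewrite lnK// posrE divr_gt0.
have L7 : 7 <= L.
  rewrite -ler_expR eL ler_pdivlMr//.
  by move: kp; rewrite expRN -ler_pdivlMl ?invr_gt0 ?expR_gt0// invrK.
have Lp : L <= ln p%:R.
  by rewrite -ler_expR eL lnK ?posrE// ler_pdivrMr// ler_peMr// ltW.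
have lp2 : ln p%:R <= ln (2 * p%:R) :> R by rewrite ler_ln ?posrE//; lra.
have rk1 : 1 <= Num.sqrt k%:R :> R by rewrite -[leLHS]sqrtr1 ler_wsqrtr.
have locD v : localized t D v -> norm2 v = 1 /\ norm1 v <= 2 * Num.sqrt k%:R.
  have Dcone : D `<=` descent_cone beta.
    move=> _ [_ [x /= x1 <-] <-]; apply: descent_cone_sub.
    have b0 : 0 <= norm1 beta by apply: sumr_ge0.
    rewrite [leLHS](_ : _ = norm1 beta * norm1 x) ?ler_piMr//.
    by rewrite /norm1 mulr_sumr; apply: eq_bigr => j _; rewrite mxE normrM (ger0_norm b0).
  move=> /(localized_descent_cone t0 Dcone)[vcone v1]; split=> //.
  exact: descent_cone_norm1 k0 bk vcone v1.
have net_hull : localized t D `|` [set 0] `<=` conv_hull (net k (p:=p)).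
  move=> v [/locD[v1 v2]|->]; last by apply: sub_conv_hull; exact: net0.
  by apply: sub_conv_hull_net => //; rewrite v1.
have g2 := gamma2_net_le k0 p0 L7 eL.
have g1 := gamma1_net_le k0 p0 L7 eL.
split; split.
- apply: (q_complexity_le _ _ C0) => S; apply: lee_natMl; [lra|exact: gamma_norm2_ge0].
- apply: le_trans (m_complexity_le _ net_hull) _; apply: le_trans g2 _.
  by rewrite lee_fin ler_wpM2r ?sqrtr_ge0//; lra.
- rewrite /q_2_infty /m_2_infty; apply: (q_complexity_le _ _ C0) => S.
  apply: (@le_trans _ _ (gamma 1 norm_infty S + gamma 2 norm2 S)%E).
    by apply: leeD2r; exact: lee_inv_sqrt_natM n0 (gamma_norm_infty_ge0 _ _).
  apply: lee_natMl; first by lra.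
  by apply: adde_ge0; [exact: gamma_norm_infty_ge0|exact: gamma_norm2_ge0].
- apply: le_trans (m_complexity_le _ net_hull) _.
  apply: le_trans (leeD g1 g2) _; rewrite -EFinD lee_fin.
  have h1 : Num.sqrt (k%:R * L) <= Num.sqrt (k%:R * L * ln p%:R).
    by apply: ler_wsqrtr; rewrite ler_peMr ?mulr_ge0//; lra.
  (* Here sqrt k L = sqrt(k L^2) and L <= ln p. *)
  have h2 : Num.sqrt k%:R * L <= Num.sqrt (k%:R * L * ln p%:R).
    have L0 : 0 <= L by lra.
    rewrite -[L in leLHS](ger0_norm L0) -sqrtr_sqr -sqrtrM//.
    by apply: ler_wsqrtr; rewrite -mulrA ler_wpM2l// expr2 ler_wpM2l.
  by lra.
- rewrite /q_0_2 /m_0_2; apply: (q_complexity_le _ _ C0) => S.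
  (* Only gamma_1 occurs in this m-complexity; it dominates both summands, whence the factor 2. *)
  apply: (@le_trans _ _ (2%:E * gamma 1 norm2 S)%E); last first.
    by apply: lee_wpmul2r; [exact: gamma_norm2_ge0|rewrite lee_fin; lra].
  rewrite (_ : 2 = 1 + 1 :> R)// EFinD ge0_muleDl ?lee_fin//.
  rewrite mul1e; apply: leeD; last exact: gamma2_norm2_le.
  exact: lee_inv_sqrt_natM n0 (gamma_norm2_ge0 _ _).
- have r0 : 0 < 2 * Num.sqrt k%:R :> R by lra.
  have cross_hull : localized t D `|` [set 0] `<=`
      conv_hull (cross_polytope (p:=p) (2 * Num.sqrt k%:R)).
    move=> v [/locD[_ v1]|->]; first exact: sub_conv_hull_cross_polytope.
    by apply: sub_conv_hull; exists None.
  apply: le_trans (m_complexity_le _ cross_hull) _.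
  have l1 : 1 <= ln (2 * p%:R) :> R by lra.
  apply: le_trans (gamma1_cross_polytope_le r0 p0 l1) _.
  by rewrite lee_fin; have := mulr_ge0 (ltW r0) (le_trans ler01 l1); lra.
Qed.
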